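(* Let $a$ and $b$ be positive integers and define $p_{a,b}\colon\mathbb{N}^2\to\mathbb{N}$ by \[ p_{a,b}(x,y)=\begin{cases} y\bigl\lfloor\sqrt[b]{y}\,\bigr\rfloor^a+x &\text{if } \bigl\lfloor\sqrt[b]{y}\,\bigr\rfloor>\bigl\lfloor\sqrt[a]{x}\,\bigr\rfloor,\\ x\Bigl(\bigl\lfloor\sqrt[a]{x}\,\bigr\rfloor+1\Bigr)^{b}+y &\text{otherwise}. \end{cases} \] Then for every integer $n>1$, $p_{a,b}$ is a base-$n$ proportional pairing function with constants of proportionality $a$ and $b$; that is, $p_{a,b}$ is a bijection from $\mathbb{N}^2$ to $\mathbb{N}$ and, for all non-negative integers $x,y,k$, if $\operatorname{len}_n(x)\le ak$ and $\operatorname{len}_n(y)\le bk$ then $\operatorname{len}_n(p_{a,b}(x,y))\le ak+bk$.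
   Context: $\mathbb{N}$ denotes the set of non-negative integers. For an integer $n>1$ and $x\in\mathbb{N}$, $\operatorname{len}_n(x)=\lceil\log_n(x+1)\rceil$ is the number of digits of the base-$n$ representation of $x$ (so $\operatorname{len}_n(0)=0$). A pairing function is a bijection $\mathbb{N}^2\to\mathbb{N}$. For positive integers $a,b$ and an integer $n>1$, a pairing function $f$ is called base-$n$ proportional with constants of proportionality $a$ and $b$ if for all non-negative integers $x,y,k$, $\operatorname{len}_n(x)\le ak$ and $\operatorname{len}_n(y)\le bk$ together imply $\operatorname{len}_n(f(x,y))\le ak+bk$. *)

(* Defs.v *)
From mathcomp Require Import all_boot all_order all_algebra.
From mathcomp Require Import reals exp.
Set Implicit Arguments.
Unset Strict Implicit.
Unset Printing Implicit Defensive.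
Import Order.TTheory GRing.Theory Num.Theory.

(* The ceiling takes values in [int]; it is nonnegative for [1 < n]. *)
Definition len (R : realType) (n x : nat) : int :=
  Num.ceil (ln (x.+1%:R : R) / ln (n%:R : R))%R.

Definition pairing_function (f : nat * nat -> nat) : Prop := bijective f.

Definition proportional_pairing (R : realType) (n a b : nat)
    (f : nat * nat -> nat) : Prop :=
  pairing_function f /\
  forall x y k : nat,
    (len R n x <= (a * k)%:Z)%R -> (len R n y <= (b * k)%:Z)%R ->
    (len R n (f (x, y)) <= (a * k + b * k)%:Z)%R.

(* [Num.truncn] is the floor on nonnegative reals, and [powR 0 r = 0] for
   [r != 0], so [x = 0] needs no special treatment when [0 < c]. *)
Definition floor_root (R : realType) (c x : nat) : nat :=
  Num.truncn (powR (x%:R : R) (c%:R^-1))%R.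

Definition pab (R : realType) (a b : nat) (u : nat * nat) : nat :=
  let: (x, y) := u in
  if floor_root R b y > floor_root R a x
  then y * floor_root R b y ^ a + x
  else x * (floor_root R a x + 1) ^ b + y.

(* Main.v *)
Require Import Defs.
From mathcomp Require Import all_boot all_order all_algebra.
From mathcomp Require Import reals exp.
Set Implicit Arguments.
Unset Strict Implicit.
Unset Printing Implicit Defensive.
Import Order.TTheory GRing.Theory Num.Theory.

(** Put [m = max (floor (x^(1/a))) (floor (y^(1/b)))].  The pairs sharing a
    value of [m] are sent onto the interval [m^(a+b), (m+1)^(a+b)), which is cut
    at [(m+1)^b * m^a]: the pairs in the first case of [p_{a,b}] fill the lower
    part and the others the upper part, each by a division with remainder.  So
    [m] and the case are recovered from the value, and then the pair.
    Proportionality holds because [len_n x <= a k] says [x^(1/a) < n^k]: if also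
    [len_n y <= b k], then [m + 1 <= n^k] and the value is below
    [n^(k(a+b))]. *)

(** Raising to the power [c] is strictly increasing on nonnegative reals and undoes the root. This
    turns every later question about real roots into one about natural numbers. *)
Lemma leq_floor_root (R : realType) (c m x : nat) :
  0 < c -> (m <= floor_root R c x) = (m ^ c <= x).
Proof.
move=> c0.
have cR0 : (0 < c%:R :> R)%R by rewrite ltr0n.
rewrite /floor_root truncn_ge_nat ?powR_ge0 //.
have powK : (powR (powR (x%:R : R) c%:R^-1) c%:R = x%:R)%R.
  by rewrite -powRrM mulVf ?gt_eqF // powRr1.
rewrite -(ler_nat R (m ^ c)) natrX -powR_mulrn // -[in RHS]powK.
apply/idP/idP => [|].
  by apply: ge0_ler_powR; rewrite ?ltW // nnegrE ?powR_ge0.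
apply: contraLR; rewrite -!ltNge.
by apply: gt0_ltr_powR; rewrite // nnegrE ?powR_ge0.
Qed.

Lemma ltn_floor_root (R : realType) (c m x : nat) :
  0 < c -> (floor_root R c x < m) = (x < m ^ c).
Proof. by move=> c0; rewrite !ltnNge leq_floor_root. Qed.

Lemma floor_root_eq (R : realType) (c m x : nat) :
  0 < c -> m ^ c <= x < m.+1 ^ c -> floor_root R c x = m.
Proof.
move=> c0 /andP[lo hi]; apply/eqP.
by rewrite eqn_leq -ltnS ltn_floor_root // hi leq_floor_root.
Qed.

Lemma floor_root_bounds (R : realType) (c x : nat) :
  0 < c -> floor_root R c x ^ c <= x < (floor_root R c x).+1 ^ c.
Proof. by move=> c0; rewrite -(leq_floor_root R) // -(ltn_floor_root R) // leqnn ltnSn. Qed.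

(** A ceiling is at most an integer iff its argument is; clearing [ln n > 0] and using monotonicity
    of [ln] leaves [x + 1 <= n ^ k]. *)
Lemma len_le (R : realType) (n x k : nat) :
  1 < n -> (len R n x <= k%:Z)%R = (x < n ^ k).
Proof.
move=> n1.
have ln0 : (0 < ln (n%:R : R))%R by rewrite ln_gt0 // ltr1n.
have n0 : (0 < n%:R :> R)%R by rewrite ltr0n (ltnW n1).
rewrite /len ceil_le_int ler_pdivrMr // -[(k%:Z%:~R)%R]/(k%:R)%R.
rewrite mulr_natl -lnXn // -natrX ler_ln ?ler_nat // posrE ltr0n //.
by rewrite expn_gt0 (ltnW n1).
Qed.

Section PairingFunction.

Variables (R : realType) (a b : nat).
Hypotheses (a_gt0 : 0 < a) (b_gt0 : 0 < b).

Definition unpab (z : nat) : nat * nat :=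
  let m := floor_root R (a + b) z in
  if z < m.+1 ^ b * m ^ a then (z %% m ^ a, z %/ m ^ a)
  else (z %/ m.+1 ^ b, z %% m.+1 ^ b).

Let ab_gt0 : 0 < a + b. Proof. by rewrite addn_gt0 a_gt0. Qed.

(** As [x] is a remainder modulo [m ^ a], the value lies in the block from [y * m ^ a] up to
    [(y + 1) * m ^ a]. *)
Lemma pab_lower_bounds (m x y : nat) :
  x < m ^ a -> m ^ b <= y < m.+1 ^ b ->
  m ^ (a + b) <= y * m ^ a + x < m.+1 ^ b * m ^ a.
Proof.
move=> xm /andP[lo hi]; apply/andP; split.
  by rewrite expnD mulnC (leq_trans _ (leq_addr _ _)) // leq_mul2r lo orbT.
apply: leq_trans (_ : y.+1 * m ^ a <= _); last by rewrite leq_mul2r hi orbT.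
by rewrite mulSn addnC ltn_add2r.
Qed.

Lemma pab_upper_bounds (m x y : nat) :
  m ^ a <= x < m.+1 ^ a -> y < m.+1 ^ b ->
  m.+1 ^ b * m ^ a <= x * m.+1 ^ b + y < m.+1 ^ (a + b).
Proof.
move=> /andP[lo hi] ym; apply/andP; split.
  by rewrite mulnC (leq_trans _ (leq_addr _ _)) // leq_mul2r lo orbT.
apply: leq_trans (_ : x.+1 * m.+1 ^ b <= _).
  by rewrite mulSn addnC ltn_add2r.
by rewrite expnD leq_mul2r hi orbT.
Qed.

Lemma shell_cut_bounds (m : nat) :
  m ^ (a + b) <= m.+1 ^ b * m ^ a <= m.+1 ^ (a + b).
Proof.
by rewrite !expnD ![_ ^ a * _]mulnC !leq_mul // leq_exp2r.
Qed.

Lemma pab_bounds (x y : nat) :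
  let m := maxn (floor_root R a x) (floor_root R b y) in
  m ^ (a + b) <= pab R a b (x, y) < m.+1 ^ (a + b).
Proof.
rewrite /= addn1; have xr := floor_root_bounds R x a_gt0.
have ys := floor_root_bounds R y b_gt0.
(* [ltnP] resolves both the test in [pab] and the [maxn]. *)
case: (ltnP (floor_root R a x)) => [|le_sr].
  rewrite ltn_floor_root // => xs; have /andP[-> hi] := pab_lower_bounds xs ys.
  by apply: leq_trans hi _; case/andP: (shell_cut_bounds (floor_root R b y)).
have yr : y < (floor_root R a x).+1 ^ b by rewrite -(ltn_floor_root R).
have /andP[lo ->] := pab_upper_bounds xr yr; rewrite andbT.
by apply: leq_trans lo; case/andP: (shell_cut_bounds (floor_root R a x)).
Qed.

Lemma pabK : cancel (pab R a b) unpab.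
Proof.
case=> x y; rewrite /unpab (floor_root_eq R ab_gt0 (pab_bounds x y)) /= addn1.
have xr := floor_root_bounds R x a_gt0; have ys := floor_root_bounds R y b_gt0.
case: (ltnP (floor_root R a x)) => [|le_sr].
  rewrite ltn_floor_root // => xs.
  have /andP[_ ->] := pab_lower_bounds xs ys.
  by rewrite modnMDl divnMDl ?(leq_ltn_trans _ xs) // divn_small // addn0 modn_small.
have yr : y < (floor_root R a x).+1 ^ b by rewrite -(ltn_floor_root R).
have /andP[lo _] := pab_upper_bounds xr yr.
by rewrite ltnNge lo /= modnMDl divnMDl ?expn_gt0 // divn_small // addn0 modn_small.
Qed.

Lemma unpabK : cancel unpab (pab R a b).
Proof.
move=> z; rewrite /unpab; have := floor_root_bounds R z ab_gt0.
move: (floor_root _ _ _) => m /andP[lo hi]; case: ltnP => cut /=.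
  (* For [m = 0] the cut is at 0, so this branch never divides by zero. *)
  have ma0 : 0 < m ^ a by case: (m ^ a) cut => //; rewrite muln0.
  rewrite (@floor_root_eq R b m); first last.
  - by rewrite leq_divRL // mulnC -expnD lo ltn_divLR.
  - by [].
  (* The quotient has root exactly [m] and the remainder a smaller one, so [pab] takes its first
     case. *)
  by rewrite ltn_floor_root // ltn_mod ma0 -divn_eq.
have mb0 : 0 < m.+1 ^ b by rewrite expn_gt0.
rewrite (@floor_root_eq R a m); first last.
- by rewrite leq_divRL // mulnC cut ltn_divLR // -expnD.
- by [].
(* Here the remainder is below [m.+1 ^ b], so its root is at most [m] and the strict test fails. *)
by rewrite ltnNge -ltnS ltn_floor_root // ltn_mod mb0 addn1 -divn_eq.
Qed.

End PairingFunction.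

Theorem theorem5p5 (R : realType) (a b : nat) (a_gt0 : 0 < a) (b_gt0 : 0 < b)
    (n : nat) (n_gt1 : 1 < n) :
  proportional_pairing R n a b (pab R a b).
Proof.
split; first by exists (unpab R a b); [exact: pabK | exact: unpabK].
move=> x y k; rewrite !len_le // ![_ * k]mulnC => xk yk.
have /andP[_ hi] := pab_bounds R a_gt0 b_gt0 x y.
(* Cancelling the common exponent [a + b] leaves [m + 1 <= n ^ k], that is, both roots are below
   [n ^ k]. *)
apply: leq_trans hi _; rewrite -mulnDr expnM leq_exp2r ?addn_gt0 ?a_gt0 //.
by rewrite gtn_max !ltn_floor_root // -!expnM xk.
Qed.
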